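(* Let $(D,\le)$ be a totally ordered set. For every finite list $X$ over $D$, $$\mathrm{IsSorted}[\mathrm{PatSort2}[X]]\quad\text{and}\quad \mathcal{M}[\mathrm{PatSort2}[X]]=\mathcal{M}[X].$$
   Context: Lists are finite lists over a totally ordered set $(D,\le)$. $\langle\rangle$ is the empty list, $a\smile U$ is the list with head $a$ and tail $U$, $U\frown a$ is the list obtained by appending the element $a$ at the end of $U$; $\langle U,V\rangle$ denotes the pair of lists $U,V$. $\mathcal{M}[U]$ is the multiset of the elements of $U$ (with multiplicities). $\mathrm{IsSorted}[U]$ means that $U$ is in non-decreasing order: $\mathrm{IsSorted}[\langle\rangle]$ holds, and $\mathrm{IsSorted}[a\smile U]$ holds iff $a\le u$ for every element $u$ of $U$ and $\mathrm{IsSorted}[U]$. $\mathrm{Merge}$ is the usual merge: $\mathrm{Merge}[\langle\rangle,V]=V$, $\mathrm{Merge}[U,\langle\rangle]=U$, $\mathrm{Merge}[a\smile U,b\smile V]=a\smile \mathrm{Merge}[U,b\smile V]$ if $a\le b$, and $=b\smile\mathrm{Merge}[a\smile U,V]$ otherwise. $\mathrm{PatSplit}$ takes elements $a,b$ and lists $X,Y,Z$ and returns a pair of lists, by recursion on the third argument: $\mathrm{PatSplit}[a,b,\langle\rangle,Y,Z]=\langle (a\smile Y)\frown b,\ Z\rangle$, and - if $c\le a$: $\mathrm{PatSplit}[a,b,c\smile X,Y,Z]=\mathrm{PatSplit}[c,b,X,a\smile Y,Z]$; - otherwise, if $b\le c$: $\mathrm{PatSplit}[a,b,c\smile X,Y,Z]=\mathrm{PatSplit}[a,c,X,Y\frown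 b,Z]$; - otherwise (i.e. $a<c<b$): $\mathrm{PatSplit}[a,b,c\smile X,Y,Z]=\mathrm{PatSplit}[a,b,X,Y,c\smile Z]$. $\mathrm{PatSort2}$ and the auxiliary $\mathrm{PatComb}$ are defined by: $\mathrm{PatSort2}[\langle\rangle]=\langle\rangle$; $\mathrm{PatSort2}[a\smile\langle\rangle]=a\smile\langle\rangle$; $\mathrm{PatSort2}[a\smile(b\smile X)]=\mathrm{PatComb}[\mathrm{PatSplit}[a,b,X,\langle\rangle,\langle\rangle]]$ if $a\le b$; $\mathrm{PatSort2}[a\smile(b\smile X)]=\mathrm{PatComb}[\mathrm{PatSplit}[b,a,X,\langle\rangle,\langle\rangle]]$ if $\neg(a\le b)$; where $\mathrm{PatComb}[\langle U,V\rangle]=\mathrm{Merge}[U,\mathrm{PatSort2}[V]]$. (The second component $V$ returned by $\mathrm{PatSplit}$ here is strictly shorter than $a\smile(b\smile X)$.) *)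

(* Defs.v *)
From Stdlib Require Import Recdef.
From mathcomp Require Import all_boot all_order.
From mathcomp Require Import finmap multiset.

Set Implicit Arguments.
Unset Strict Implicit.
Unset Printing Implicit Defensive.

Local Open Scope order_scope.

Definition Multiset (disp : Order.disp_t) (D : orderType disp) (U : seq D) :
  {mset D}%mset := seq_mset U.

(* On [a :: U], [pairwise <=%O] unfolds to
   [all (<=%O a) U && pairwise <=%O U]. *)
Definition IsSorted (disp : Order.disp_t) (D : orderType disp) (U : seq D) :
  bool := pairwise <=%O U.

Definition Merge (disp : Order.disp_t) (D : orderType disp) (U V : seq D) :
  seq D := merge <=%O U V.

Lemma MergeE (disp : Order.disp_t) (D : orderType disp) :
  [/\ forall V : seq D, Merge [::] V = V,
      forall U : seq D, Merge U [::] = U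
    & forall (a b : D) (U V : seq D),
        Merge (a :: U) (b :: V) =
        if a <= b then a :: Merge U (b :: V) else b :: Merge (a :: U) V].
Proof. by split=> //; case. Qed.

Fixpoint PatSplit (disp : Order.disp_t) (D : orderType disp)
    (a b : D) (X Y Z : seq D) {struct X} : seq D * seq D :=
  match X with
  | [::] => (rcons (a :: Y) b, Z)
  | c :: X' =>
    if c <= a then PatSplit c b X' (a :: Y) Z
    else if b <= c then PatSplit a c X' (rcons Y b) Z
    else PatSplit a b X' Y (c :: Z)
  end.

Lemma size_PatSplit2 (disp : Order.disp_t) (D : orderType disp)
    (a b : D) (X Y Z : seq D) :
  (size (PatSplit a b X Y Z).2 <= size X + size Z)%N.
Proof.
elim: X a b Y Z => //= c X IH a b Y Z.
do 2?[case: ifP => _]; try exact: leq_trans (IH _ _ _ _) (leqW (leqnn _)).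
by rewrite addSnnS; exact: IH.
Qed.

(* The mutually recursive auxiliary function [PatComb] is inlined here; it is
   recovered below, with the defining equations of the pair in [PatSort2E]. *)
Function PatSort2 (disp : Order.disp_t) (D : orderType disp) (X : seq D)
    {measure size X} : seq D :=
  match X with
  | [::] => [::]
  | [:: a] => [:: a]
  | a :: b :: X' =>
    if a <= b then
      let UV := PatSplit a b X' [::] [::] in Merge UV.1 (PatSort2 UV.2)
    else
      let UV := PatSplit b a X' [::] [::] in Merge UV.1 (PatSort2 UV.2)
  end.
Proof.
- move=> disp D X a l b X' _ _ _; apply/ltP.
  by have := size_PatSplit2 a b X' [::] [::]; rewrite addn0 => /leqW.
- move=> disp D X a l b X' _ _ _; apply/ltP.
  by have := size_PatSplit2 b a X' [::] [::]; rewrite addn0 => /leqW.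
Defined.

Arguments PatSort2 {disp D} X.

Definition PatComb (disp : Order.disp_t) (D : orderType disp)
    (UV : seq D * seq D) : seq D :=
  Merge UV.1 (PatSort2 UV.2).

Lemma PatSort2E (disp : Order.disp_t) (D : orderType disp) :
  [/\ PatSort2 [::] = [::] :> seq D,
      forall a : D, PatSort2 [:: a] = [:: a],
      forall (a b : D) (X : seq D), a <= b ->
        PatSort2 [:: a, b & X] = PatComb (PatSplit a b X [::] [::]),
      forall (a b : D) (X : seq D), ~~ (a <= b) ->
        PatSort2 [:: a, b & X] = PatComb (PatSplit b a X [::] [::])
    & forall U V : seq D, PatComb (U, V) = Merge U (PatSort2 V)].
Proof.
split=> //; try by move=> *; rewrite PatSort2_equation.
- by move=> a b X le_ab; rewrite PatSort2_equation le_ab.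
- by move=> a b X /negbTE le_ab; rewrite PatSort2_equation le_ab.
Qed.

(* Main.v *)
(* Throughout PatSplit the list [(a :: Y) ++ [:: b]] stays sorted, so only its
   two endpoints are compared with the next element: a new element is put at
   an end or set aside. *)
Require Import Defs.
From mathcomp Require Import all_boot all_order.
From mathcomp Require Import finmap multiset.
From mathcomp Require Import zify.

Set Implicit Arguments.
Unset Strict Implicit.
Unset Printing Implicit Defensive.

Import Order.TTheory.

(** Each [PatSplit] extracts a sorted list and sets aside a shorter rest, with no element lost or
    duplicated ([sorted_PatSplit1], [perm_PatSplit]). By induction along the recursion of [PatSort2]
    the rest gets sorted, and merging two sorted lists yields a sorted list of all their
    elements. *)

Lemma IsSorted_sorted (disp : Order.disp_t) (D : orderType disp) (U : seq D) :
  IsSorted U = sorted <=%O U.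
Proof. by rewrite /IsSorted sorted_pairwise //; exact: le_trans. Qed.

Lemma sorted_PatSplit1 (disp : Order.disp_t) (D : orderType disp)
    (a b : D) (X Y Z : seq D) :
  path <=%O a (rcons Y b) -> sorted <=%O (PatSplit a b X Y Z).1.
Proof.
elim: X a b Y Z => [|c X IH] a b Y Z //= sY.
case: ifP => [le_ca|_]; first by apply: IH; rewrite /= le_ca.
case: ifP => [le_bc|_]; last exact: IH.
by apply: IH; rewrite rcons_path sY last_rcons.
Qed.

Lemma perm_PatSplit (disp : Order.disp_t) (D : orderType disp)
    (a b : D) (X Y Z : seq D) :
  perm_eq ((PatSplit a b X Y Z).1 ++ (PatSplit a b X Y Z).2)
          ([:: a, b & X] ++ Y ++ Z).
Proof.
elim: X a b Y Z => [|c X IH] a b Y Z /=.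
  by rewrite perm_cons cat_rcons perm_sym -(cat1s b) perm_catCA.
do 2?[case: ifP => _]; rewrite (permPl (IH _ _ _ _));
  (* Counting an arbitrary predicate [p] on both sides turns each rearrangement into linear
     arithmetic. *)
  apply/permP => p; rewrite /= !count_cat /= -?cats1 ?count_cat /=; lia.
Qed.

(** [V] stands for the result of the recursive call, so that one statement serves both orders of the
    first two elements. *)
Lemma Merge_PatSplit_correct (disp : Order.disp_t) (D : orderType disp)
    (a b : D) (X V : seq D) :
  (a <= b)%O -> sorted <=%O V ->
  perm_eq V (PatSplit a b X [::] [::]).2 ->
  sorted <=%O (Merge (PatSplit a b X [::] [::]).1 V) /\
  perm_eq (Merge (PatSplit a b X [::] [::]).1 V) [:: a, b & X].
Proof.
move=> le_ab sV pV; split.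
  apply: merge_sorted => //; first exact: le_total.
  by apply: sorted_PatSplit1; rewrite /= le_ab.
rewrite /Merge perm_merge.
have := perm_PatSplit a b X [::] [::]; rewrite !cats0.
by apply: perm_trans; rewrite perm_cat2l.
Qed.

Lemma PatSort2_correct (disp : Order.disp_t) (D : orderType disp) (X : seq D) :
  sorted <=%O (PatSort2 X) /\ perm_eq (PatSort2 X) X.
Proof.
apply PatSort2_ind => {X} [//|//|_ a b X _ le_ab UV [sV pV]|].
  exact: Merge_PatSplit_correct.
move=> _ a b X _ [//|/negbT nle_ab] _ UV [sV pV].
have le_ba : (b <= a)%O by rewrite ltW // ltNge.
have [sM pM] := Merge_PatSplit_correct le_ba sV pV; split=> //.
(* The split started from [b] and [a]; the two heads are swapped back. *)
by rewrite (permPl pM) -[[:: b, a & X]]/([:: b] ++ [:: a] ++ X) perm_catCA.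
Qed.

Theorem theorem3 (disp : Order.disp_t) (D : orderType disp) (X : seq D) :
  IsSorted (PatSort2 X) /\ Multiset (PatSort2 X) = Multiset X.
Proof.
have [sX pX] := PatSort2_correct X; rewrite IsSorted_sorted; split=> //.
exact/eq_seq_msetP.
Qed.
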